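(* Let $E$ be a propositional variable, $s$ an agent, and $c$ a justification constant. Let $\mathcal{F}=\{c:_s(E\wedge\neg(\exists x)x:_sE\rightarrow E)\}$. Then $\mathsf{QLP}^-_{\mathcal{F}}\vdash\neg(\exists y)y:_s[E\wedge\neg(\exists x)x:_sE]$ (in the multi-agent version of $\mathsf{QLP}^-$).
   Context: Let $\mathcal{A}=\{1,\dots,n\}$ be a set of agents. Fix countably many justification variables, propositional variables, and primitive function symbols of each arity $k\ge0$ (arity $0$: justification constants); a primitive term is $f(x_1,\dots,x_k)$ with $x_i$ variables. Terms: $t::= x\mid f(x_1,\dots,x_k)\mid t\cdot t\mid t+t\mid !t$. Formulas: $A::= p\mid\bot\mid\neg A\mid A\wedge A\mid A\vee A\mid A\rightarrow A\mid t:_iA\mid(\forall x)A\mid(\exists x)A$ with $i\in\mathcal{A}$ and $x$ a justification variable. Axioms (for every agent $i$): all propositional tautologies; Q1: $(\forall x)A(x)\rightarrow A(t)$, $t$ free for $x$; Q2: $(\forall x)(A\rightarrow B(x))\rightarrow(A\rightarrow(\forall x)B(x))$, $x$ not free in $A$; Q3: $A(t)\rightarrow(\exists x)A(x)$, $t$ free for $x$; Q4: $(\forall x)(A(x)\rightarrow B)\rightarrow((\exists x)A(x)\rightarrow B)$, $x$ not free in $B$; jK: $s':_i(A\rightarrow B)\rightarrow(t:_iA\rightarrow(s'\cdot t):_iB)$; jT: $t:_iA\rightarrow A$; j4: $t:_iA\rightarrow !t:_it:_iA$; Sum: $s':_iA\rightarrow(s'+t):_iA$, $s':_iA\rightarrow(t+s'):_iA$.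 Rules: Modus Ponens; Gen: from $A$ infer $(\forall x)A$; Axiom Necessitation: from an axiom instance $A$ infer $f(x_1,\dots,x_k):_iA$. For a set $\mathcal{F}$ of formulas $f(x_1,\dots,x_k):_iA$ with $A$ an axiom instance, $\mathsf{QLP}^-_{\mathcal{F}}$ is the logic in which Axiom Necessitation only produces members of $\mathcal{F}$. *)

(* Defs.v *)
From mathcomp Require Import all_boot.

Set Implicit Arguments.
Unset Strict Implicit.
Unset Printing Implicit Defensive.

Notation jvar := nat (only parsing).
Notation pvar := nat (only parsing).

(* Countably many primitive function symbols for each arity [k]; symbols of
   different arities are different symbols, since [Prim] below records [k]. *)
Definition fsymbol (k : nat) : Type := nat.

(* Primitive function symbols are applied to variables only. *)
Inductive term : Type :=
| Var (x : jvar)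
| Prim (k : nat) (f : fsymbol k) (xs : k.-tuple jvar)
| App (s t : term)
| Plus (s t : term)
| Bang (t : term).

(* The agents 1, ..., n are the elements of ['I_n]; [Just t i A] is t :_i A. *)
Inductive formula (n : nat) : Type :=
| Atom (p : pvar)
| Bot
| Neg (A : formula n)
| And (A B : formula n)
| Or (A B : formula n)
| Imp (A B : formula n)
| Just (t : term) (i : 'I_n) (A : formula n)
| All (x : jvar) (A : formula n)
| Ex (x : jvar) (A : formula n).

Arguments Atom {n} p.
Arguments Bot {n}.

Fixpoint occurs (x : jvar) (t : term) : bool :=
  match t with
  | Var y => x == y
  | Prim _ _ ys => x \in (ys : seq nat)
  | App u v | Plus u v => occurs x u || occurs x v
  | Bang u => occurs x u
  end.

Fixpoint is_free n (x : jvar) (A : formula n) : bool :=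
  match A with
  | Atom _ | Bot => false
  | Neg B => is_free x B
  | And B C | Or B C | Imp B C => is_free x B || is_free x C
  | Just t _ B => occurs x t || is_free x B
  | All y B | Ex y B => (x != y) && is_free x B
  end.

Fixpoint free_for n (t : term) (x : jvar) (A : formula n) : bool :=
  match A with
  | Atom _ | Bot => true
  | Neg B | Just _ _ B => free_for t x B
  | And B C | Or B C | Imp B C => free_for t x B && free_for t x C
  | All y B | Ex y B =>
      ~~ is_free x A || (~~ occurs y t && free_for t x B)
  end.

(* Substitution is partial: f(x_1, ..., x_k) takes variables as arguments, so
   if x is one of the x_j, replacing x by t gives a term only when t is a
   variable.  The result is [None] when it is not an expression of the
   language. *)
Fixpoint tsubst (x : jvar) (t u : term) : option term :=
  match u with
  | Var y => Some (if y == x then t else Var y)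
  | Prim k f ys =>
      if x \in (ys : seq nat) then
        if t is Var z then
          Some (Prim f [tuple of map (fun y => if y == x then z else y) ys])
        else None
      else Some (Prim f ys)
  | App v w =>
      obind (fun v' => omap (App v') (tsubst x t w)) (tsubst x t v)
  | Plus v w =>
      obind (fun v' => omap (Plus v') (tsubst x t w)) (tsubst x t v)
  | Bang v => omap Bang (tsubst x t v)
  end.

(* Replaces the free occurrences of x in A by t, without renaming bound
   variables. *)
Fixpoint fsubst n (x : jvar) (t : term) (A : formula n) : option (formula n) :=
  match A with
  | Atom p => Some (Atom p)
  | Bot => Some Bot
  | Neg B => omap (@Neg n) (fsubst x t B)
  | And B C => obind (fun B' => omap (And B') (fsubst x t C)) (fsubst x t B)
  | Or B C => obind (fun B' => omap (Or B') (fsubst x t C)) (fsubst x t B)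
  | Imp B C => obind (fun B' => omap (Imp B') (fsubst x t C)) (fsubst x t B)
  | Just u i B =>
      obind (fun u' => omap (Just u' i) (fsubst x t B)) (tsubst x t u)
  | All y B => if y == x then Some (All y B) else omap (All y) (fsubst x t B)
  | Ex y B => if y == x then Some (Ex y B) else omap (Ex y) (fsubst x t B)
  end.

(* Formulas that are not built by a propositional connective are treated as
   propositional atoms, with arbitrary truth values given by [v]. *)
Fixpoint prop_eval n (v : formula n -> bool) (A : formula n) : bool :=
  match A with
  | Bot => false
  | Neg B => ~~ prop_eval v B
  | And B C => prop_eval v B && prop_eval v C
  | Or B C => prop_eval v B || prop_eval v C
  | Imp B C => prop_eval v B ==> prop_eval v C
  | Atom _ | Just _ _ _ | All _ _ | Ex _ _ => v A
  end.

Definition tautology n (A : formula n) : Prop := forall v, prop_eval v A.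

Inductive axiom_instance n : formula n -> Prop :=
| ax_taut A : tautology A -> axiom_instance A
| ax_Q1 x t A At : free_for t x A -> fsubst x t A = Some At ->
    axiom_instance (Imp (All x A) At)
| ax_Q2 x A B : ~~ is_free x A ->
    axiom_instance (Imp (All x (Imp A B)) (Imp A (All x B)))
| ax_Q3 x t A At : free_for t x A -> fsubst x t A = Some At ->
    axiom_instance (Imp At (Ex x A))
| ax_Q4 x A B : ~~ is_free x B ->
    axiom_instance (Imp (All x (Imp A B)) (Imp (Ex x A) B))
| ax_jK i s t A B :
    axiom_instance (Imp (Just s i (Imp A B))
                        (Imp (Just t i A) (Just (App s t) i B)))
| ax_jT i t A : axiom_instance (Imp (Just t i A) A)
| ax_j4 i t A :
    axiom_instance (Imp (Just t i A) (Just (Bang t) i (Just t i A)))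
| ax_SumL i s t A :
    axiom_instance (Imp (Just s i A) (Just (Plus s t) i A))
| ax_SumR i s t A :
    axiom_instance (Imp (Just s i A) (Just (Plus t s) i A)).

(* Theoremhood in QLP^-_F.  Members of F that are not of the form
   f(x_1, ..., x_k) :_i A with A an axiom instance have no effect. *)
Inductive provable n (F : formula n -> Prop) : formula n -> Prop :=
| pr_axiom A : axiom_instance A -> provable F A
| pr_MP A B : provable F (Imp A B) -> provable F A -> provable F B
| pr_Gen x A : provable F A -> provable F (All x A)
| pr_AN k (f : fsymbol k) (xs : k.-tuple jvar) i A :
    axiom_instance A -> F (Just (Prim f xs) i A) ->
    provable F (Just (Prim f xs) i A).

(* Main.v *)
Require Import Defs.
From mathcomp Require Import all_boot.

(* Knower-style argument.  Let K be E /\ ~ (exists x) x :_s E.  If y :_s K,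
   then (c . y) :_s E by jK, hence (exists x) x :_s E, whereas K itself holds
   by jT and refutes it.  Generalising over y and applying Q4 concludes. *)

(** Used with [A] as y :_s K, [B] as (c . y) :_s E, [C] as the existential and [D] as [E]; one
    tautology chains the three premises. *)
Lemma provable_absurd n (F : formula n -> Prop) (A B C D : formula n) :
  provable F (Imp A B) -> provable F (Imp B C) ->
  provable F (Imp A (And D (Neg C))) -> provable F (Imp A Bot).
Proof.
move=> AB BC ADC; apply: pr_MP ADC; apply: pr_MP BC; apply: pr_MP AB.
apply/pr_axiom/ax_taut => v /=.
by case: (prop_eval v A) (prop_eval v B) (prop_eval v C) => [] [] [] //=;
  rewrite andbF.
Qed.

Lemma provable_Neg n (F : formula n -> Prop) (A : formula n) :
  provable F (Imp A Bot) -> provable F (Neg A).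
Proof.
apply: pr_MP; apply/pr_axiom/ax_taut => v /=.
by case: (prop_eval v A).
Qed.

Lemma provable_Neg_Ex n (F : formula n -> Prop) (x : jvar) (A : formula n) :
  provable F (Imp A Bot) -> provable F (Neg (Ex x A)).
Proof.
move=> nA; apply: provable_Neg; apply: pr_MP (pr_Gen x nA).
(* The side condition of Q4 holds because [Bot] has no free variable. *)
exact/pr_axiom/ax_Q4.
Qed.

Theorem theorem31 (n : nat) (s : 'I_n) (E : pvar) (c : fsymbol 0) (x y : jvar) :
  provable
    (fun B : formula n =>
       B = Just (Prim c (nil_tuple nat)) s
             (Imp (And (Atom E) (Neg (Ex x (Just (Var x) s (Atom E)))))
                  (Atom E)))
    (Neg (Ex y (Just (Var y) s
             (And (Atom E) (Neg (Ex x (Just (Var x) s (Atom E)))))))).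
Proof.
set K := And _ _; set F := fun _ => _.
have cF : provable F (Just (Prim c (nil_tuple nat)) s (Imp K (Atom E))).
  (* [K] has [E] as its first conjunct. *)
  apply: pr_AN => //; apply: ax_taut => v /=.
  by apply/implyP => /andP[].
apply: provable_Neg_Ex.
apply: (@provable_absurd _ _ _
  (Just (App (Prim c (nil_tuple nat)) (Var y)) s (Atom E))
  (Ex x (Just (Var x) s (Atom E))) (Atom E)).
- exact: pr_MP (pr_axiom _ (ax_jK _ _ _ _ _)) cF.
(* The witness for [x] is the term c . y; it is free for [x] as the body has no quantifier. *)
- by apply/pr_axiom/ax_Q3 => //=; rewrite eqxx.
- exact/pr_axiom/ax_jT.
Qed.
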